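(* Let $(X,\|\cdot\|)$ be a normed space and $p>1$. Then the following hold: (i) $G(p;k)=\varnothing$ for all $k=0,\dots,n-2$; (ii) $G(p;n-1)$ is the set of all $(\mu_1,\dots,\mu_n)$ for which there exists $j\in\{1,\dots,n\}$ such that $\mu_j>0$, $\mu_i<0$ for all $i\neq j$, and $$\mu_j^{\frac{1}{p-1}}\geq 1+\sum_{i=1,\,i\neq j}^n|\mu_i|^{\frac{1}{p-1}};$$ (iii) $G(p;n)=\mathbb{R}^-\times\cdots\times\mathbb{R}^-$ ($n$ factors), where $\mathbb{R}^-=\{t\in\mathbb{R}: t<0\}$; (iv) $G(p)=G(p;n-1)\cup G(p;n)$.
   Context: For a normed space $(X,\|\cdot\|)$, a positive integer $n$ and $p>0$, let $G(p)$ be the set of all $n$-tuples $(\mu_1,\dots,\mu_n)\in\mathbb{R}^n$ (with all $\mu_i\neq 0$, so that the fractions make sense) such that $$\left\|\sum_{i=1}^n x_i\right\|^p\geq\sum_{i=1}^n\frac{\|x_i\|^p}{\mu_i}\quad\text{for all } x_1,\dots,x_n\in X.$$ For $k=0,1,\dots,n$, let $G(p;k)$ be the subset of those $(\mu_1,\dots,\mu_n)\in G(p)$ for which exactly $k$ of the numbers $\mu_1,\dots,\mu_n$ are negative.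
   Formalization: The normed space X is assumed to be nonzero; for X = {0} the inequality defining G(p) is always 0 ≥ 0, so G(p) contains every tuple with nonzero entries and the theorem fails (for instance (ii) for every n, and (i) for n ≥ 2). *)

(* Defs.v *)
From HB Require Import structures.
From mathcomp Require Import all_boot all_order all_algebra.
From mathcomp Require Import all_classical all_reals all_analysis.

Set Implicit Arguments.
Unset Strict Implicit.
Unset Printing Implicit Defensive.

Import Order.TTheory GRing.Theory Num.Theory.
Import numFieldNormedType.Exports.

Local Open Scope classical_set_scope.
Local Open Scope ring_scope.

(* The condition mu_i != 0 is explicit because division is total: 1 / 0 = 0. *)
Definition G (R : realType) (X : normedModType R) (n : nat) (p : R) :
    set 'rV[R]_n :=
  [set mu | (forall i : 'I_n, mu 0 i != 0) /\
            (forall x : 'I_n -> X,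
               `|\sum_(i < n) x i| `^ p >=
               \sum_(i < n) `|x i| `^ p / mu 0 i)].

Definition Gneg (R : realType) (X : normedModType R) (n : nat) (p : R)
    (k : nat) : set 'rV[R]_n :=
  [set mu | G X p mu /\ #|[pred i : 'I_n | mu 0 i < 0]| = k].

(* Main.v *)
Require Import Defs.
From HB Require Import structures.
From mathcomp Require Import all_boot all_order all_algebra.
From mathcomp Require Import all_classical all_reals all_analysis.
From mathcomp Require Import zify ring lra.

Set Implicit Arguments.
Unset Strict Implicit.
Unset Printing Implicit Defensive.

Import Order.TTheory GRing.Theory Num.Theory.
Import numFieldNormedType.Exports.

Local Open Scope classical_set_scope.
Local Open Scope ring_scope.

(** The condition on [mu] is decided by scalar multiples of one nonzero vector.
    Two positive entries are excluded by a pair of opposite vectors: their sum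
    vanishes while the weighted sum is positive.  Hence at most one entry is
    positive, and if none is, the weighted sum is nonpositive and the
    inequality is trivial.  So everything reduces to the case of one positive
    entry [mu_j], the others being negative.  Put [t_i = |mu_i|^(1/(p-1))] for
    [i != j] and [T = 1 + \sum_(i != j) t_i]; the inequality reads, with
    [s = \sum_i x_i],

      [|x_j|^p / mu_j <= |s|^p + \sum_(i != j) |x_i|^p / t_i^(p-1)].

    As [x_j] is [s] minus the other [x_i], the triangle inequality and Radon's
    inequality ([radon_powR]), applied with weight [1] for [s] and [t_i] for
    [x_i], bound the right-hand side below by [|x_j|^p / T^(p-1)].  This gives
    the sufficiency of [T <= mu_j^(1/(p-1))] ([G_dominant]).  The equality case
    of Radon's inequality is the one where the vectors are proportional to
    their weights, so taking [s = v] and [x_i = - t_i v] shows that the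
    condition is also necessary ([G_pos_bound]).  The four assertions then
    follow by counting negative entries. *)

(** * Real powers and Radon's inequality *)

Lemma powR_root_subr1 (R : realType) (p m : R) : 1 < p -> 0 <= m ->
  (m `^ (1 / (p - 1))) `^ (p - 1) = m.
Proof.
move=> p1 m0; rewrite -powRrM div1r mulVf ?powRr1//.
by rewrite subr_eq0 gt_eqF.
Qed.

(** The graph of [x |-> x ^ p] lies above its tangent at [u]; this is Young's
    inequality for [y] and [u ^ (p - 1)] with the conjugate exponents [p] and
    [p / (p - 1)]. *)
Lemma powR_ge_tangent (R : realType) (p u y : R) : 1 < p -> 0 <= u -> 0 <= y ->
  u `^ p + p * u `^ (p - 1) * (y - u) <= y `^ p.
Proof.
move=> p1 u0 y0.
have p0 : 0 < p by rewrite (lt_trans _ p1).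
have q0 : 0 < p - 1 by rewrite subr_gt0.
have conj : p^-1 + (p / (p - 1))^-1 = 1.
  by field; rewrite !gt_eqF.
have := conjugate_powR y0 (powR_ge0 u (p - 1)) p0 (divr_gt0 p0 q0) conj.
rewrite -powRrM mulrC -[(p - 1) * _](_ : p = _); last by field; rewrite gt_eqF.
rewrite -(ler_pM2l p0) mulrDr (mulrC (y `^ p)) mulVKf ?gt_eqF//.
rewrite (_ : p * (u `^ p / (p / (p - 1))) = (p - 1) * u `^ p); last first.
  by field; rewrite !gt_eqF.
by rewrite -(mulr_powRB1 u0 p0); lra.
Qed.

Lemma perspective_powR (R : realType) (p a t : R) : 0 <= a -> 0 < t -> 1 < p ->
  t * (a / t) `^ p = a `^ p / t `^ (p - 1).
Proof.
move=> a0 t0 p1; have p0 : 0 < p by rewrite (lt_trans _ p1).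
have ti0 : 0 <= t^-1 by rewrite invr_ge0 ltW.
rewrite powRM// -powR_inv1 ?ltW// -powRrM mulN1r powRN.
rewrite -(mulr_powRB1 (ltW t0) p0) invfM mulrCA mulVKf ?gt_eqF//.
Qed.

(** Radon's inequality: sum the tangent inequalities at the weighted mean [u]
    of the points [a i / t i]; the linear terms cancel. *)
Lemma radon_powR (R : realType) (I : finType) (p : R) (a t : I -> R) : 1 < p ->
  (forall i, 0 <= a i) -> (forall i, 0 < t i) ->
  (\sum_i a i) `^ p / (\sum_i t i) `^ (p - 1)
    <= \sum_i a i `^ p / t i `^ (p - 1).
Proof.
move=> p1 a0 t0; set A := \sum_i a i; set T := \sum_i t i.
have A0 : 0 <= A by exact: sumr_ge0.
have : 0 <= T by apply: sumr_ge0 => i _; exact: ltW.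
rewrite le_eqVlt => /predU1P[<-|T0].
  (* the empty sum: the left-hand side is a quotient by 0 *)
  rewrite powR0 ?subr_eq0 ?gt_eqF// invr0 mulr0.
  by apply: sumr_ge0 => i _; rewrite divr_ge0 ?powR_ge0.
rewrite -perspective_powR//; set u := A / T.
have u0 : 0 <= u by rewrite divr_ge0// ltW.
have -> : T * u `^ p =
    \sum_i (t i * u `^ p + p * u `^ (p - 1) * (a i - u * t i)).
  rewrite big_split/= -mulr_suml -mulr_sumr sumrB -mulr_sumr -/A -/T.
  by rewrite divfK ?gt_eqF// subrr mulr0 addr0.
apply: ler_sum => i _; rewrite -perspective_powR//.
have := powR_ge_tangent p1 u0 (divr_ge0 (a0 i) (ltW (t0 i))).
move=> /(ler_wpM2l (ltW (t0 i))); apply: le_trans.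
rewrite le_eqVlt; apply/predU1P; left.
by field; rewrite gt_eqF.
Qed.

(** * Sign patterns of the tuples in G *)

Section SignPatterns.
Variables (R : realType) (X : normedModType R) (n : nat) (p : R).
Hypothesis p1 : 1 < p.
Implicit Type mu : 'rV[R]_n.

Let p0 : 0 < p. Proof. exact: lt_trans p1. Qed.
Let q0 : 0 < p - 1. Proof. by rewrite subr_gt0. Qed.

Lemma G_all_neg mu : (forall i, mu 0 i < 0) -> G X p mu.
Proof.
move=> mu0; split=> [i|x]; first by rewrite lt_eqF.
apply: (@le_trans _ _ 0); last exact: powR_ge0.
by apply: sumr_le0 => i _; rewrite mulr_ge0_le0 ?powR_ge0// invr_le0 ltW.
Qed.

(** Radon's inequality for the norms of [s = \sum_i x i] and of the [x i] with
    [i != j], whose total is at least [`|x j|] by the triangle inequality. *)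
Lemma G_dominant mu j : 0 < mu 0 j -> (forall i, i != j -> mu 0 i < 0) ->
  1 + \sum_(i < n | i != j) `|mu 0 i| `^ (1 / (p - 1))
    <= mu 0 j `^ (1 / (p - 1)) ->
  G X p mu.
Proof.
move=> muj mui le_mu; split=> [i|x].
  by have [->|/mui/lt_eqF->] := eqVneq i j; rewrite ?gt_eqF.
set s := \sum_i x i.
(* the slot j carries the whole sum s, with weight 1 *)
pose a i := if i == j then `|s| else `|x i|.
pose t i := if i == j then 1 else `|mu 0 i| `^ (1 / (p - 1)).
have a0 i : 0 <= a i by rewrite /a; case: ifP.
have t0 i : 0 < t i.
  rewrite /t; case: eqVneq => // /mui mui0.
  by rewrite powR_gt0// normr_gt0 lt_eqF.
have big_j (F : 'I_n -> R) y :
    \sum_i (if i == j then y else F i) = y + \sum_(i < n | i != j) F i.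
  rewrite (bigD1 j)//= eqxx; congr (_ + _).
  by apply: eq_bigr => i /negPf ->.
have xj_le : `|x j| <= \sum_i a i.
  have -> : x j = s - \sum_(i < n | i != j) x i.
    by rewrite /s (bigD1 j)//= addrK.
  rewrite big_j; apply: (le_trans (ler_normB _ _)).
  by rewrite lerD2l ler_norm_sum.
have T0 : 0 < \sum_i t i.
  by rewrite big_j ltr_wpDr// sumr_ge0// => i _; rewrite powR_ge0.
have T_le : (\sum_i t i) `^ (p - 1) <= mu 0 j.
  rewrite -[leRHS](powR_root_subr1 p1 (ltW muj)) ge0_ler_powR ?nnegrE//.
  - exact: ltW.
  - exact: ltW.
  - exact: powR_ge0.
  - by rewrite big_j.
have main : `|x j| `^ p / mu 0 j
    <= `|s| `^ p + \sum_(i < n | i != j) `|x i| `^ p / `|mu 0 i|.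
  have -> : `|s| `^ p + \sum_(i < n | i != j) `|x i| `^ p / `|mu 0 i| =
      \sum_i a i `^ p / t i `^ (p - 1).
    rewrite -big_j; apply: eq_bigr => i _; rewrite /a /t; case: ifP => _.
      by rewrite powR1 divr1.
    by rewrite powR_root_subr1.
  apply: le_trans (radon_powR p1 a0 t0).
  apply: ler_pM; rewrite ?powR_ge0 ?invr_ge0 ?(ltW muj)//.
    by rewrite ge0_ler_powR ?nnegrE ?sumr_ge0 ?(ltW p0).
  by rewrite lef_pV2 ?posrE ?powR_gt0.
rewrite (bigD1 j)//= -lerBrDr; apply: (le_trans main).
rewrite lerD2l -sumrN; apply: ler_sum => i /mui mui0.
by rewrite ltr0_norm// invrN mulrN.
Qed.

(** On a line, the condition defining [G] only involves real numbers. *)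
Lemma G_scalar mu (c : 'I_n -> R) : (exists x : X, x != 0) -> G X p mu ->
  \sum_i `|c i| `^ p / mu 0 i <= `|\sum_i c i| `^ p.
Proof.
case=> v v0 [_ Gmu].
have v_gt0 : 0 < `|v| `^ p by rewrite powR_gt0 ?normr_gt0.
rewrite -(ler_pM2r v_gt0) mulr_suml -powRM// -normrZ scaler_suml.
rewrite (eq_bigr (fun i => `|c i *: v| `^ p / mu 0 i)) => [|i _].
  exact: Gmu.
by rewrite normrZ powRM// mulrAC.
Qed.

(** Opposite vectors in the slots [i] and [j] have sum zero, whereas the
    weighted sum of their norms is positive. *)
Lemma G_pos_unique mu i j : (exists x : X, x != 0) -> G X p mu ->
  0 < mu 0 i -> 0 < mu 0 j -> i = j.
Proof.
move=> hX Gmu mui muj; apply/eqP/negPn/negP => ij.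
pose c k : R := if k == i then 1 else if k == j then -1 else 0.
have c0 k : k != i -> k != j -> c k = 0 by rewrite /c => /negPf-> /negPf->.
have ci : c i = 1 by rewrite /c eqxx.
have cj : c j = -1 by rewrite /c eqxx eq_sym (negPf ij).
have ji : j != i by rewrite eq_sym.
have := G_scalar c hX Gmu.
rewrite (bigD1 i)//= (bigD1 j)//= big1 => [|k /andP[ki kj]]; last first.
  by rewrite c0// normr0 powR0 ?mul0r// gt_eqF.
rewrite (bigD1 i)//= (bigD1 j)//= big1 => [|k /andP[ki kj]]; last by rewrite c0.
rewrite ci cj normrN normr1 powR1 !addr0 subrr normr0 powR0 ?gt_eqF//.
by rewrite leNgt !mul1r addr_gt0 ?invr_gt0.
Qed.

(** The test coefficients give [(1 + S) ^ p / mu_j - S <= 1], that is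
    [(1 + S) ^ (p - 1) <= mu_j]. *)
Lemma G_pos_bound mu j : (exists x : X, x != 0) -> G X p mu ->
  0 < mu 0 j -> (forall i, i != j -> mu 0 i < 0) ->
  1 + \sum_(i < n | i != j) `|mu 0 i| `^ (1 / (p - 1))
    <= mu 0 j `^ (1 / (p - 1)).
Proof.
move=> hX Gmu muj mui.
pose t i := `|mu 0 i| `^ (1 / (p - 1)).
rewrite -/(\sum_(i < n | i != j) t i); set S := \sum_(i < n | i != j) t i.
have S0 : 0 <= S by apply: sumr_ge0 => i _; exact: powR_ge0.
have T0 : 0 < 1 + S by rewrite ltr_wpDr.
(* equality case of Radon's inequality: coefficients proportional to the
   weights, with total sum 1 *)
pose c i := if i == j then 1 + S else - t i.
have := G_scalar c hX Gmu.
have -> : \sum_i c i = 1.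
  rewrite (bigD1 j)//= /c eqxx (eq_bigr (fun i => - t i)).
    by rewrite sumrN addrK.
  by move=> i /negPf->.
have -> : \sum_i `|c i| `^ p / mu 0 i = (1 + S) `^ p / mu 0 j - S.
  rewrite (bigD1 j)//= {1}/c eqxx gtr0_norm// -sumrN; congr (_ + _).
  apply: eq_bigr => i ij; rewrite /c (negPf ij) normrN ger0_norm ?powR_ge0//.
  rewrite -(mulr_powRB1 (powR_ge0 _ _) p0) powR_root_subr1//.
  by rewrite -/(t i) ltr0_norm ?mui// mulrN mulNr mulfK// lt_eqF ?mui.
rewrite normr1 powR1 lerBlDr ler_pdivrMr// -(mulr_powRB1 (ltW T0) p0).
rewrite ler_pM2l// => le_mu.
have : ((1 + S) `^ (p - 1)) `^ (1 / (p - 1)) <= mu 0 j `^ (1 / (p - 1)).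
  by rewrite ge0_ler_powR ?nnegrE ?powR_ge0 ?divr_ge0 ?(ltW q0) ?(ltW muj).
by rewrite -powRrM div1r mulfV ?gt_eqF// powRr1// ltW.
Qed.

Lemma G_sign_cases mu : (exists x : X, x != 0) -> G X p mu ->
  (forall i, mu 0 i < 0) \/
  exists j, 0 < mu 0 j /\ forall i, i != j -> mu 0 i < 0.
Proof.
move=> hX Gmu; have [/forallP neg|] := boolP [forall i, mu 0 i < 0].
  by left.
have mu_neg i : ~~ (0 < mu 0 i) -> mu 0 i < 0.
  by rewrite -leNgt le_eqVlt (negPf (Gmu.1 i)).
rewrite negb_forall => /existsP[j]; rewrite -leNgt le_eqVlt eq_sym.
rewrite (negPf (Gmu.1 j)) => /= muj; right; exists j; split=> // i ij.
by apply: mu_neg; apply: contra ij => mui; rewrite (G_pos_unique hX Gmu mui muj).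
Qed.

End SignPatterns.

(** * Counting negative entries *)

Lemma card_all_neg (R : realType) (n : nat) (mu : 'rV[R]_n) :
  (forall i, mu 0 i < 0) -> #|[pred i : 'I_n | mu 0 i < 0]| = n.
Proof. by move=> neg; rewrite eq_cardT ?size_enum_ord// => i; apply: neg. Qed.

Lemma card_one_pos (R : realType) (n : nat) (mu : 'rV[R]_n) (j : 'I_n) :
  0 < mu 0 j -> (forall i, i != j -> mu 0 i < 0) ->
  #|[pred i : 'I_n | mu 0 i < 0]| = n.-1.
Proof.
move=> muj neg; rewrite -[n in n.-1]card_ord -(cardC1 j); apply: eq_card => i.
rewrite !inE; have [->|/neg->//] := eqVneq i j.
by rewrite ltNge ltW.
Qed.

(* X is assumed nonzero: for X = {0} the inequality defining G is void and
   (i), (ii) and (iv) fail (n >= 2). *)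
Theorem theorem2p6 (R : realType) (X : normedModType R)
    (hX : exists x : X, x != 0)
    (n : nat) (hn : (0 < n)%N) (p : R) (hp : 1 < p) :
  [/\ (forall k : nat, (k + 2 <= n)%N -> @Gneg R X n p k = set0),
      @Gneg R X n p n.-1 =
        [set mu : 'rV[R]_n | exists j : 'I_n,
           [/\ 0 < mu 0 j,
               (forall i : 'I_n, i != j -> mu 0 i < 0) &
               mu 0 j `^ (1 / (p - 1)) >=
                 1 + \sum_(i < n | i != j) `|mu 0 i| `^ (1 / (p - 1))]],
      @Gneg R X n p n = [set mu : 'rV[R]_n | forall i : 'I_n, mu 0 i < 0] &
      @G R X n p = @Gneg R X n p n.-1 `|` @Gneg R X n p n].
Proof.
have npred : n.-1 != n by rewrite neq_ltn prednK ?leqnn.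
split.
- move=> k kn; apply/seteqP; split=> // mu [Gmu cardk].
  have [/card_all_neg|[j [muj /(card_one_pos muj)]]] := G_sign_cases hp hX Gmu;
    rewrite cardk => kE; lia.
- apply/seteqP; split=> mu.
  + move=> [Gmu cardk]; have [/card_all_neg|] := G_sign_cases hp hX Gmu.
      by rewrite cardk => /eqP; rewrite (negPf npred).
    by move=> [j [muj neg]]; exists j; split=> //; exact: G_pos_bound hX Gmu _ _.
  + move=> [j [muj neg le_mu]]; split; last exact: card_one_pos muj neg.
    exact: G_dominant muj neg le_mu.
- apply/seteqP; split=> mu.
  + move=> [Gmu cardk]; have [//|] := G_sign_cases hp hX Gmu.
    move=> [j [muj /(card_one_pos muj)]]; rewrite cardk => /eqP.
    by rewrite eq_sym (negPf npred).
  + by move=> neg; split; [exact: G_all_neg|exact: card_all_neg].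
- apply/seteqP; split=> mu; last by case=> -[].
  move=> Gmu; have [neg|[j [muj neg]]] := G_sign_cases hp hX Gmu.
    by right; split=> //; exact: card_all_neg.
  by left; split=> //; exact: card_one_pos muj neg.
Qed.
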